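(* Let $k\ge 1$ and $n>k+1$ be integers. Then $$ \tau_{n,k}\geq \frac{(2k-1)!!}{(n+k-1)(n+k-3)\cdots(n-k+1)}. $$
   Context: $T_n$ is the $n$-th Chebyshev polynomial of the first kind, $T_n(\cos\theta)=\cos n\theta$, and $T_n^{(k)}$ is its $k$-th derivative. For integers $k\ge1$ and $n\geq k+2$, $\omega_{n,k}$ denotes the largest (rightmost) zero of the polynomial $T_n^{(k+1)}$ (all of whose zeros are real and lie in $(-1,1)$), and $$\tau_{n,k}:=\frac{|T_n^{(k)}(\omega_{n,k})|}{T_n^{(k)}(1)}.$$ Notation: $(2k-1)!!=1\cdot3\cdots(2k-1)$. The product $(n+k-1)(n+k-3)\cdots(n-k+1)$ has $k$ factors decreasing in steps of $2$, i.e. it equals $\prod_{j=1}^{k}(n+k+1-2j)$. *)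

(* Defs.v *)
From mathcomp Require Import all_boot all_order all_algebra.
From mathcomp Require Import all_classical all_reals all_analysis.
From mathcomp Require Import ring lra.

Set Implicit Arguments.
Unset Strict Implicit.
Unset Printing Implicit Defensive.

Import Order.TTheory GRing.Theory Num.Theory.
Local Open Scope ring_scope.
Local Open Scope classical_set_scope.

(* By [chebP] below, this is the only polynomial p such that
   p.[cos t] = cos (n t) for all t. *)
Fixpoint cheb (R : realType) (n : nat) : {poly R} :=
  match n with
  | 0 => 1
  | m.+1 => match m with
            | 0 => 'X
            | l.+1 => 2%:P * 'X * cheb R m - cheb R l
            end
  end.

Lemma cheb_cos (R : realType) (n : nat) (t : R) :
  (cheb R n).[cos t] = cos (n%:R * t).
Proof.
suff: (cheb R n).[cos t] = cos (n%:R * t) /\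
      (cheb R n.+1).[cos t] = cos (n.+1%:R * t) by case.
elim: n => [|n [IH0 IH1]]; first by rewrite /= hornerX hornerC mul0r cos0 mul1r.
split=> //.
have -> : cheb R n.+2 = 2%:P * 'X * cheb R n.+1 - cheb R n by [].
rewrite !hornerE IH0 IH1.
have -> : n.+2%:R * t = n.+1%:R * t + t by rewrite -(natr1 n.+1); ring.
have -> : n%:R * t = n.+1%:R * t - t by rewrite -(natr1 n); ring.
rewrite cosB cosD; ring.
Qed.

Lemma chebP (R : realType) (n : nat) (p : {poly R}) :
  (forall t : R, p.[cos t] = cos (n%:R * t)) <-> p = cheb R n.
Proof.
split=> [hp|-> t]; last exact: cheb_cos.
apply/eqP; rewrite -subr_eq0; apply/eqP.
set q := p - _.
pose s := [seq (i.+1%:R^-1 : R) | i <- iota 0 (size q)].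
apply: (@roots_geq_poly_eq0 _ q s); last by rewrite size_map size_iota.
  apply/allP => _ /mapP[i _ ->].
  have hi : (i.+1%:R^-1 : R) \in `[(-1), 1]%R.
    rewrite in_itv /= invf_le1 ?ltr0n// ler1n andbT.
    by rewrite (@le_trans _ _ 0) ?lerN10 ?invr_ge0.
  by rewrite /root /q -(acosK hi) !hornerE hp cheb_cos subrr.
rewrite map_inj_uniq ?iota_uniq// => i j /invr_inj /eqP.
by rewrite eqr_nat => /eqP[].
Qed.

Definition is_largest_root (R : realType) (p : {poly R}) (w : R) : Prop :=
  root p w /\ forall x : R, root p x -> x <= w.

(* The default value 0 of [xget] is only relevant when no largest zero exists,
   which does not happen for k + 2 <= n. *)
Definition omega (R : realType) (n k : nat) : R :=
  xget 0 [set w : R | is_largest_root (cheb R n)^`(k.+1) w].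

Definition tau (R : realType) (n k : nat) : R :=
  `|(cheb R n)^`(k).[omega R n k]| / (cheb R n)^`(k).[1].

(* Main.v *)
(* With y = T_n^(k), Sonin's function f = (n^2 - k^2) y^2 + (1 - x^2) y'^2 has
   derivative 4 k x y'^2, so it increases on [0, omega], where omega >= 0 by
   parity; hence (n^2 - k^2) y(omega)^2 >= f(0).  Writing D_k for the product
   (n+k-1)(n+k-3)...(n-k+1), one has D_{k+2} = (n^2 - (k+1)^2) D_k, the values
   of T_n^(k) and T_n^(k+1) at 0 lie on the ellipse
   (u / (n D_{k-1}))^2 + (v / (n D_k))^2 = 1, and
   D_k^2 >= (n^2 - k^2) D_{k-1}^2 yields |y(omega)| >= n D_{k-1}.  Finally
   (2k-1)!! T_n^(k)(1) = n D_k D_{k-1}, which turns this into the bound. *)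
Require Import Defs.
From mathcomp Require Import all_boot all_order all_algebra.
From mathcomp Require Import all_classical all_reals all_analysis.
From mathcomp Require Import polyrcf ring lra zify.

Import Order.TTheory GRing.Theory Num.Theory.
Local Open Scope ring_scope.

(** * Differential equations for the Chebyshev derivatives *)

Lemma chebSS (R : realType) n :
  cheb R n.+2 = 2%:P * 'X * cheb R n.+1 - cheb R n.
Proof. by []. Qed.

(** Under [x = cos t] these are addition formulas for [sin t * sin (n t)]. They are proved as a pair
    because the recurrence reaches back two steps. *)
Lemma deriv_cheb_mul (R : realType) n :
  (1 - 'X^2) * (cheb R n)^`() = n%:R * ('X * cheb R n - cheb R n.+1) /\
  (1 - 'X^2) * (cheb R n.+1)^`() = n.+1%:R * (cheb R n - 'X * cheb R n.+1).
Proof.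
elim: n => [|n [IH0 IH1]].
  by split; rewrite /= ?derivX -?polyC1 ?derivC; ring.
split; first by rewrite IH1 chebSS polyCMn; ring.
rewrite {1}chebSS derivB !derivM derivC derivX.
have -> : (1 - 'X^2 : {poly R}) * ((0 * 'X + 2%:P * 1) * cheb R n.+1 +
    2%:P * 'X * (cheb R n.+1)^`() - (cheb R n)^`()) =
  2%:P * (1 - 'X^2) * cheb R n.+1 + 2%:P * 'X * ((1 - 'X^2) * (cheb R n.+1)^`())
   - (1 - 'X^2) * (cheb R n)^`() by ring.
by rewrite IH0 IH1 chebSS !polyCMn; ring.
Qed.

Lemma deriv_natr (R : nzRingType) n : (n%:R : {poly R})^`() = 0.
Proof. by rewrite -polyC_natr derivC. Qed.

Lemma deriv_1BX2 (R : nzRingType) : (1 - 'X^2 : {poly R})^`() = - ('X *+ 2).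
Proof. by rewrite derivB derivXn -polyC1 derivC sub0r. Qed.

Lemma cheb_ode (R : realType) n :
  (1 - 'X^2) * (cheb R n)^`(2) - 'X * (cheb R n)^`(1)
    + (n%:R ^+ 2) * cheb R n = 0.
Proof.
have [h0 h1] := deriv_cheb_mul R n.
have nz : (1 - 'X^2 : {poly R}) != 0.
  apply/eqP => /(congr1 (fun p : {poly R} => p.[0])).
  by rewrite !hornerE expr0n /= subr0 => /eqP; rewrite oner_eq0.
have := congr1 (@deriv R) h0.
rewrite 2!derivM deriv_1BX2 deriv_natr derivB derivM derivX.
rewrite derivn1 (_ : (cheb R n)^`(2) = (cheb R n)^`()^`()) // => h2.
(* The extra factor [1 - 'X^2] lets [h0] and [h1] eliminate every first derivative. *)
apply: (mulfI nz); rewrite mulr0.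
have {}h2 : (1 - 'X^2) * (cheb R n)^`()^`() =
  n%:R * (cheb R n + 'X * (cheb R n)^`() - (cheb R n.+1)^`())
   + 2 * 'X * (cheb R n)^`().
  by rewrite -[LHS](addKr (- ('X *+ 2) * (cheb R n)^`())) h2; ring.
rewrite h2.
transitivity (n%:R * ((1 - 'X^2) * cheb R n + 'X * ((1 - 'X^2) * (cheb R n)^`())
   - (1 - 'X^2) * (cheb R n.+1)^`()) + 'X * ((1 - 'X^2) * (cheb R n)^`())
   + n%:R ^+ 2 * (1 - 'X^2) * cheb R n); first by ring.
rewrite h0 h1; ring.
Qed.

(** Each differentiation adds 2 to the middle coefficient, through [1 - 'X^2], and moves [2m+1] into
    the last one: [m^2 + 2m + 1 = (m+1)^2]. *)
Lemma cheb_derivn_ode (R : realType) n m :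
  (1 - 'X^2) * (cheb R n)^`(m.+2) - (m.*2.+1)%:R * 'X * (cheb R n)^`(m.+1)
    + ((n ^ 2)%:R - (m ^ 2)%:R) * (cheb R n)^`(m) = 0.
Proof.
elim: m => [|m IH].
  by rewrite -[RHS](cheb_ode R n) derivn0 double0 !natrX; ring.
have := congr1 (@deriv R) IH.
rewrite deriv0 derivD derivB 2!derivM deriv_1BX2 derivM derivM derivB.
rewrite !deriv_natr derivX -!derivnS => h.
rewrite -[RHS]h doubleS -!muln2 !natrX; ring.
Qed.

Lemma cheb_derivn_ode_at (R : realType) n m (x : R) :
  (1 - x ^+ 2) * (cheb R n)^`(m.+2).[x]
    - (m%:R * 2 + 1) * x * (cheb R n)^`(m.+1).[x]
    + (n%:R ^+ 2 - m%:R ^+ 2) * (cheb R n)^`(m).[x] = 0.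
Proof.
have := congr1 (fun p : {poly R} => p.[x]) (cheb_derivn_ode R n m).
rewrite -!polyC_natr !hornerE => <-; rewrite -muln2; ring.
Qed.

(** * Values at 1 and at 0 *)

Lemma cheb_at1 (R : realType) n : (cheb R n).[1] = 1.
Proof. by rewrite -cos0 cheb_cos mulr0. Qed.

(** At 1 the leading term of the differential equation vanishes, leaving a first-order recurrence in
    [k]. *)
Lemma cheb_derivn_at1 (R : realType) n k :
  (\prod_(1 <= j < k.+1) (2 * j%:R - 1)) * (cheb R n)^`(k).[1]
  = \prod_(0 <= i < k) (n%:R ^+ 2 - i%:R ^+ 2).
Proof.
elim: k => [|k IH]; first by rewrite !big_nil mul1r derivn0 cheb_at1.
rewrite big_nat_recr //= [RHS]big_nat_recr //= -IH.
have := cheb_derivn_ode_at R n k 1; rewrite expr1n subrr mul0r sub0r mulr1.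
by rewrite -(natr1 k) => h; rewrite -mulrA -[RHS]mulrA; congr (_ * _); lra.
Qed.

Lemma cheb_at0_sqr (R : realType) n :
  (cheb R n).[0] ^+ 2 + (cheb R n.+1).[0] ^+ 2 = 1.
Proof.
elim: n => [|n IH]; first by rewrite /= !hornerE /=; ring.
rewrite chebSS -[RHS]IH !hornerE; ring.
Qed.

Lemma cheb_at0_sqr_deriv (R : realType) n :
  n%:R ^+ 2 * (cheb R n).[0] ^+ 2 + (cheb R n)^`().[0] ^+ 2 = n%:R ^+ 2.
Proof.
have [h _] := deriv_cheb_mul R n; have e := cheb_at0_sqr R n.
set b := cheb R n.+1 in h e.
have := congr1 (fun p : {poly R} => p.[0]) h.
rewrite -polyC_natr !hornerE expr0n /= subr0 mul1r => ->.
rewrite -[RHS]mulr1 -[X in _ = _ * X]e; ring.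
Qed.

(** * The products [D_k] and the ellipse relation *)

Definition step2_prod (R : realType) (n k : nat) : R :=
  \prod_(1 <= j < k.+1) (n%:R + k%:R + 1 - 2 * j%:R).

Lemma step2_prod0 (R : realType) n : step2_prod R n 0 = 1.
Proof. by rewrite /step2_prod big_nil. Qed.

Lemma step2_prod1 (R : realType) n : step2_prod R n 1 = n%:R.
Proof. by rewrite /step2_prod big_nat1; ring. Qed.

(** The two outermost factors are [n + k + 1] and [n - k - 1]; the inner ones form the product for
    [k]. *)
Lemma step2_prodSS (R : realType) n k :
  step2_prod R n k.+2 = (n%:R ^+ 2 - k.+1%:R ^+ 2) * step2_prod R n k.
Proof.
rewrite /step2_prod big_nat_recr //= big_nat_recl //= big_add1 /=.
rewrite [in RHS]big_add1 /=.
rewrite mulrAC; congr (_ * _); first by rewrite -!natr1; ring.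
by apply: eq_bigr => i _; rewrite -!natr1; ring.
Qed.

Lemma step2_prod_gt0 (R : realType) n k : (k < n)%N -> 0 < step2_prod R n k.
Proof.
move=> kn; rewrite /step2_prod big_nat; apply: prodr_gt0 => j /andP[_ jk].
have : (2 * j < n + k + 1)%N by lia.
by rewrite -(ltr_nat R) natrM !natrD => ?; lra.
Qed.

Lemma step2_prod_mul (R : realType) n k :
  n%:R * step2_prod R n k.+1 * step2_prod R n k
  = \prod_(0 <= i < k.+1) (n%:R ^+ 2 - i%:R ^+ 2).
Proof.
elim: k => [|k IH]; first by rewrite step2_prod1 step2_prod0 big_nat1; ring.
by rewrite big_nat_recr //= -IH step2_prodSS; ring.
Qed.

Lemma step2_prod_sqr_ge (R : realType) n k : (k.+1 < n)%N ->
  (n%:R ^+ 2 - k.+1%:R ^+ 2) * step2_prod R n k ^+ 2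
  <= step2_prod R n k.+1 ^+ 2.
Proof.
elim/ltn_ind: k => -[|[|k]] IH kn.
- by rewrite step2_prod1 step2_prod0 expr1n; lra.
- rewrite step2_prodSS step2_prod0 step2_prod1; nra.
have {}IH := IH k (leqnSn _) (ltnW (ltnW kn)).
rewrite !step2_prodSS exprMn [leRHS]exprMn.
set a := n%:R ^+ 2 - k.+2%:R ^+ 2 in IH *.
set b := n%:R ^+ 2 - k.+1%:R ^+ 2 in IH *.
set c := n%:R ^+ 2 - k.+3%:R ^+ 2.
apply: (@le_trans _ _ (a ^+ 2 * (b * step2_prod R n k ^+ 2))); last first.
  by rewrite ler_wpM2l ?sqr_ge0.
have b0 : 0 <= b.
  by rewrite subr_ge0 lerXn2r ?nnegrE ?ler_nat ?ler0n //; lia.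
(* The difference [a ^+ 2 - c * b] equals [2 n^2 + 2 (k+2)^2 - 1]. *)
have cb : c * b <= a ^+ 2.
  rewrite /a /b /c -!natr1; have : 0 <= k%:R :> R by rewrite ler0n.
  by nra.
have -> : c * (b ^+ 2 * step2_prod R n k ^+ 2)
    = c * b * (b * step2_prod R n k ^+ 2) by ring.
by rewrite ler_wpM2r // mulr_ge0 ?sqr_ge0.
Qed.

(* The ellipse relation between the two values at 0, without denominators. *)
Lemma cheb_derivn_at0 (R : realType) n m :
  (cheb R n)^`(m.+1).[0] ^+ 2 * step2_prod R n m.+1 ^+ 2
    + (cheb R n)^`(m.+2).[0] ^+ 2 * step2_prod R n m ^+ 2
  = (n%:R * step2_prod R n m.+1 * step2_prod R n m) ^+ 2.
Proof.
have rec i : (cheb R n)^`(i.+2).[0]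
    = - (n%:R ^+ 2 - i%:R ^+ 2) * (cheb R n)^`(i).[0].
  by have := cheb_derivn_ode_at R n i 0; rewrite expr0n /=; lra.
elim: m => [|m IH].
  rewrite step2_prod1 step2_prod0 rec derivn0 derivn1.
  transitivity (n%:R ^+ 2 * (n%:R ^+ 2 * (cheb R n).[0] ^+ 2
    + (cheb R n)^`().[0] ^+ 2)); first by ring.
  by rewrite cheb_at0_sqr_deriv; ring.
(* The new derivative value and the new product both carry the factor [n^2 - (m+1)^2], so the
   relation is only rescaled by its square. *)
rewrite (rec m.+1) step2_prodSS.
transitivity ((n%:R ^+ 2 - m.+1%:R ^+ 2) ^+ 2 *
 ((cheb R n)^`(m.+1).[0] ^+ 2 * step2_prod R n m.+1 ^+ 2
    + (cheb R n)^`(m.+2).[0] ^+ 2 * step2_prod R n m ^+ 2)); first by ring.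
rewrite IH; ring.
Qed.

(** * Monotonicity of Sonin's function *)

Lemma ge_horner_deriv_ge0 (R : rcfType) (p : {poly R}) a b : a <= b ->
  (forall x, a <= x -> x <= b -> 0 <= p^`().[x]) -> p.[a] <= p.[b].
Proof.
rewrite le_eqVlt => /predU1P[->//|ab] h.
have [c] := poly_mvt p ab; rewrite in_itv /= => /andP[ac cb] e.
by rewrite -subr_ge0 e mulr_ge0 ?subr_ge0 ?h 1?ltW.
Qed.

Lemma sonin_le (R : realType) n k (w : R) : 0 <= w ->
  (cheb R n)^`(k.+1).[w] = 0 ->
  (n%:R ^+ 2 - k%:R ^+ 2) * (cheb R n)^`(k).[0] ^+ 2
    + (cheb R n)^`(k.+1).[0] ^+ 2
  <= (n%:R ^+ 2 - k%:R ^+ 2) * (cheb R n)^`(k).[w] ^+ 2.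
Proof.
move=> w0 yw.
pose y := (cheb R n)^`(k); pose z := (cheb R n)^`(k.+1).
pose f : {poly R} := (n%:R ^+ 2 - k%:R ^+ 2)%:P * (y * y) + (1 - 'X^2) * (z * z).
have df (x : R) : f^`().[x] = 4 * k%:R * x * z.[x] ^+ 2.
  have := cheb_derivn_ode_at R n k x; rewrite -/y -/z => h.
  rewrite /f derivD !derivM deriv_1BX2 derivC -!derivnS -/z.
  apply/eqP; rewrite -subr_eq0; apply/eqP.
  (* The difference of the two sides is [2 * z.[x]] times the differential equation [h]. *)
  rewrite -[RHS](mulr0 (2 * z.[x])) -[in RHS]h !hornerE /=; ring.
have : f.[0] <= f.[w].
  apply: ge_horner_deriv_ge0 => // x x0 _.
  by rewrite df mulr_ge0 ?sqr_ge0 // !mulr_ge0.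
rewrite /f !hornerE /= /z yw !mulr0 addr0 -/y; lra.
Qed.

(** * Parity, real zeros and the existence of [omega] *)

Lemma cheb_derivnN (R : realType) n m (x : R) :
  (cheb R n)^`(m).[- x] = (-1) ^+ (n + m) * (cheb R n)^`(m).[x].
Proof.
have sgnS i : ((-1) ^+ i.+1)%:P = - ((-1) ^+ i)%:P :> {poly R}.
  by rewrite exprS mulN1r polyCN.
have compN i : cheb R i \Po (- 'X) = ((-1) ^+ i)%:P * cheb R i /\
    cheb R i.+1 \Po (- 'X) = ((-1) ^+ i.+1)%:P * cheb R i.+1.
  elim: i => [|i [IH0 IH1]].
    by rewrite /= comp_polyX -polyC1 comp_polyC !expr0 !polyCN; split; ring.
  split=> //; rewrite chebSS comp_polyB !comp_polyM comp_polyX comp_polyC.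
  by rewrite IH0 IH1 !sgnS; ring.
suff h : (cheb R n)^`(m) \Po (- 'X) = ((-1) ^+ (n + m))%:P * (cheb R n)^`(m).
  have := congr1 (fun p : {poly R} => p.[x]) h.
  by rewrite horner_comp hornerCM hornerN hornerX.
elim: m => [|m IH]; first by rewrite addn0 derivn0 (compN n).1.
have := congr1 (@deriv R) IH.
rewrite deriv_comp derivN derivX derivM derivC -!derivnS addnS sgnS mulrN1 => h.
by apply: oppr_inj; rewrite h; ring.
Qed.

(* Rolle's theorem between consecutive elements of [a :: s]. *)
Lemma deriv_roots_between (R : rcfType) (p : {poly R}) a s :
  p.[a] = 0 -> path <%R a s -> all (root p) s ->
  exists t, [/\ size t = size s, path <%R a t & all (root p^`()) t].
Proof.
elim: s a => [|b s IH] a pa /=; first by exists [::].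
move=> /andP[ab bs] /andP[/rootP pb ps].
have [t [st bt pt]] := IH b pb bs ps.
have [c] := poly_rolle ab (etrans pa (esym pb)).
rewrite in_itv /= => /andP[ac cb] p'c.
exists (c :: t); rewrite /= st ac pt andbT; split => //; last exact/rootP.
by case: t bt {st pt} => //= d t /andP[/(lt_trans cb) -> ->].
Qed.

(** Iterated Rolle: each derivative costs one zero, and truncated subtraction covers an exhausted
    list. *)
Lemma derivn_sorted_roots (R : rcfType) (p : {poly R}) s m :
  sorted <%R s -> all (root p) s ->
  exists t, [/\ size t = (size s - m)%N, sorted <%R t & all (root p^`(m)) t].
Proof.
move=> ss ps; elim: m => [|m [t [st sot pt]]].
  by exists s; rewrite subn0 derivn0.
case: t st sot pt => [|a t] st sot pt.
  by exists [::]; split => //=; rewrite subnS -st.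
case/andP: pt => /rootP pa pt.
have [u [su ssu pu]] := deriv_roots_between _ _ _ _ pa sot pt.
exists u; split; [by rewrite subnS -st su | exact: path_sorted ssu |].
by rewrite derivnS.
Qed.

Lemma cheb_sorted_roots (R : realType) n :
  exists s, [/\ size s = n, sorted <%R s & all (root (cheb R n)) s].
Proof.
case: n => [|n]; first by exists [::].
pose t i : R := (i%:R * 2 + 1) / (n.+1%:R * 2) * pi.
pose s := [seq cos (t i) | i <- iota 0 n.+1].
(* The cosines decrease with [i], hence the sorting; they are distinct since [cos] is injective on
   [[0, pi]]. *)
exists (sort <=%R s); rewrite size_sort size_map size_iota; split => //.
  rewrite sort_lt_sorted map_inj_in_uniq ?iota_uniq // => i j.
  rewrite !mem_iota !add0n /= => hi hj.
  have t_in l : (l < n.+1)%N -> t l \in `[0, pi].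
    move=> hl; rewrite in_itv /= /t mulr_ge0 ?pi_ge0 ?divr_ge0 ?addr_ge0 ?mulr_ge0 //=.
    rewrite -[leRHS]mul1r ler_wpM2r ?pi_ge0 // ler_pdivrMr ?mul1r ?mulr_gt0 //.
    by rewrite -natrM -natrM natr1 ler_nat; lia.
  move=> /cos_inj -/(_ (t_in i hi) (t_in j hj)).
  rewrite /t => /(mulIf (lt0r_neq0 (pi_gt0 R))) /mulIf h.
  apply/eqP; rewrite -(eqr_nat R); apply/eqP.
  have /h : (n.+1%:R * 2 : R)^-1 != 0 by rewrite invr_eq0 -natrM pnatr_eq0.
  by lra.
rewrite all_sort; apply/allP => _ /mapP[i _ ->]; apply/rootP.
rewrite cheb_cos.
have -> : n.+1%:R * t i = pi / 2 + pi *+ i.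
  rewrite /t -mulr_natr; field.
  by rewrite nat1r pnatr_eq0.
elim: i => [|i IH]; first by rewrite addr0 cos_pihalf.
by rewrite (mulrSr pi) addrA cosDpi IH oppr0.
Qed.

Lemma largest_root_exists (R : realType) (p : {poly R}) x :
  p != 0 -> root p x -> exists w, is_largest_root p w.
Proof.
move=> p0 px; have mem := roots_on_rootsR p0.
have maxP (s : seq R) a : exists2 w, w \in a :: s & {in a :: s, forall y, y <= w}.
  elim: s a => [|b s IH] a; first by exists a => [|y]; rewrite inE // => /eqP->.
  have [w ws wmax] := IH b.
  exists (Num.max a w).
    by case: leP => _; rewrite inE ?eqxx // ws orbT.
  by move=> y; rewrite inE le_max => /predU1P[->|/wmax ->]; rewrite ?lexx ?orbT.
have : x \in rootsR p by rewrite -mem in_itv.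
case: (rootsR p) mem => // a s mem _.
have [w ws wmax] := maxP s a; exists w; split.
  by move: ws; rewrite -mem => /andP[].
by move=> y py; apply: wmax; rewrite -mem in_itv.
Qed.

Lemma cheb_derivn_at1_gt0 (R : realType) n k :
  (k <= n)%N -> 0 < (cheb R n)^`(k).[1].
Proof.
move=> kn; have odd0 : 0 < \prod_(1 <= j < k.+1) (2 * j%:R - 1) :> R.
  rewrite big_nat; apply: prodr_gt0 => j /andP[j1 _].
  by move: j1; rewrite -(ler_nat R) => ?; lra.
rewrite -(pmulr_rgt0 _ odd0) cheb_derivn_at1 big_nat.
apply: prodr_gt0 => i /andP[_ ik].
rewrite subr_gt0 ltrXn2r ?nnegrE ?ler0n //= ltr_nat; lia.
Qed.

(** Rolle leaves [n - k - 1 > 0] zeros, and positivity at 1 excludes the zero polynomial, so [xget]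
    does not return its default. *)
Lemma omegaP (R : realType) n k : (k + 1 < n)%N ->
  is_largest_root (cheb R n)^`(k.+1) (omega R n k).
Proof.
move=> kn; rewrite /omega; apply: xgetPex.
have [s [ss sos ps]] := cheb_sorted_roots R n.
have [[|x t] [st _ pt]] := derivn_sorted_roots _ _ s k.+1 sos ps.
  by move: st; rewrite ss /=; lia.
apply: (@largest_root_exists _ _ x); last by case/andP: pt.
apply/eqP => p0; have := cheb_derivn_at1_gt0 R n k.+1.
by rewrite p0 horner0 ltxx => /(_ _)-/implyP; rewrite implybF; lia.
Qed.

Lemma omega_ge0 (R : realType) n k : (k + 1 < n)%N -> 0 <= omega R n k.
Proof.
move=> /(omegaP R)[/rootP r wmax].
have /wmax : root (cheb R n)^`(k.+1) (- omega R n k).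
  by apply/rootP; rewrite cheb_derivnN r mulr0.
lra.
Qed.

(** * Combining Sonin's inequality with the ellipse relation *)

Theorem corollary1p6 (R : realType) (n k : nat) :
  (1 <= k)%N -> (k + 1 < n)%N ->
  (\prod_(1 <= j < k.+1) (2 * j%:R - 1)) /
    (\prod_(1 <= j < k.+1) (n%:R + k%:R + 1 - 2 * j%:R))
  <= tau R n k.
Proof.
(* With [k.+1] in place of [k], the product [D_{k-1}] becomes [step2_prod R n k]. *)
case: k => // k _ kn; rewrite -/(step2_prod R n k.+1).
have w0 := omega_ge0 R n k.+1 kn.
have [/rootP yw _] := omegaP R n k.+1 kn.
have := sonin_le R n k.+1 _ w0 yw.
rewrite /tau; set yk := (cheb R n)^`(k.+1); set w := omega R n k.+1 => son.
have y1_gt0 : 0 < yk.[1] by apply: cheb_derivn_at1_gt0; lia.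
have D_gt0 : 0 < step2_prod R n k by apply: step2_prod_gt0; lia.
have D1_gt0 : 0 < step2_prod R n k.+1 by apply: step2_prod_gt0; lia.
have := step2_prod_mul R n k; rewrite -cheb_derivn_at1 -/yk => prodE.
have l_gt0 : 0 < n%:R ^+ 2 - k.+1%:R ^+ 2 :> R.
  by rewrite subr_gt0 ltrXn2r ?nnegrE ?ler0n //= ltr_nat; lia.
have key : n%:R * step2_prod R n k <= `|yk.[w]|.
  have nD0 : 0 <= n%:R * step2_prod R n k by rewrite mulr_ge0 ?ler0n ?ltW.
  rewrite -(ler_pXn2r (n := 2)) ?nnegrE // real_normK ?num_real //.
  rewrite -(ler_pM2l l_gt0); apply: le_trans son.
  rewrite -(ler_pM2l (exprn_gt0 2 D1_gt0)).
  have e := cheb_derivn_at0 R n k.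
  have {}kn : (k.+1 < n)%N by lia.
  have g := step2_prod_sqr_ge R n k kn.
  have E2 : 0 <= (cheb R n)^`(k.+2).[0] ^+ 2 by rewrite sqr_ge0.
  (* By the ellipse relation [e], the gap to be shown nonnegative is exactly the square in [E2]
     times the slack in [g]. *)
  rewrite -subr_ge0 in g; have := mulr_ge0 E2 g.
  rewrite -subr_ge0; congr (_ <= _).
  transitivity (step2_prod R n k.+1 ^+ 2 * (cheb R n)^`(k.+2).[0] ^+ 2
    + (n%:R ^+ 2 - k.+1%:R ^+ 2) * ((cheb R n)^`(k.+1).[0] ^+ 2 *
     step2_prod R n k.+1 ^+ 2 - (n%:R * step2_prod R n k.+1 * step2_prod R n k) ^+ 2)).
    by rewrite -e; ring.
  by rewrite /yk; ring.
(* Once denominators are cleared, [prodE] makes the claim [key] multiplied by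
   [step2_prod R n k.+1]. *)
rewrite ler_pdivrMr // mulrAC ler_pdivlMr // -prodE.
by rewrite mulrAC ler_wpM2r // ltW.
Qed.
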